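(* Let $G$ be an even-linked graph, let $C$ and $C'$ be the unique odd cycles of $G$, let $X$ be the set of vertices in $V(C)\cup V(C')$ having degree $2$ in $G$, and let $(A,B)$ be the bipartition of the (connected bipartite) graph $G-X$ with $|A|=|B|+1$. Then: (1) $|\mathrm{corona}(G)|+|\mathrm{core}(G)|=2\alpha(G)$; (2) $N(\mathrm{core}(G))=A$; (3) $\mathrm{corona}(G)$ and $N(\mathrm{core}(G))$ form a partition of $V(G)$.
   Context: All graphs are finite, simple and undirected. $\alpha(G)$ is the maximum size of an independent set of $G$; $\mathrm{core}(G)$ and $\mathrm{corona}(G)$ are the intersection and the union, respectively, of all maximum independent sets of $G$. For $S\subseteq V(G)$, $N(S)=\bigcup_{v\in S}N(v)$. A graph $G$ is $2$-bicritical if $|N(S)|>|S|$ for every nonempty independent set $S\subseteq V(G)$. Let $H$ be a subgraph of $G$. An ear with respect to $H$ is an odd-length path whose endpoints lie in $H$ and whose internal vertices are distinct and lie outside $H$. A pendant with respect to $H$ is an odd cycle $D$, vertex-disjoint from $H$, together with a simple path of positive length with one end in $D$ and the other in $H$, all of whose other vertices lie outside both $H$ and $D$. A connected $2$-bicritical graph $G$ with exactly two odd cycles (counted as subgraphs) is an even-linked graph if there is a sequence $G_0,G_1,\dots,G_p=G$ such that $G_0$ is an odd cycle, $G_1$ is obtained from $G_0$ by adding a pendant, $G_i$ is obtained from $G_{i-1}$ by adding an ear for $i=2,\dots,p$, and the path of $G_1$ that connects its two odd cycles has even length. It is known that for such $G$, with $C,C',X$ as in the claim, $G-X$ is connected and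 bipartite with a bipartition $(A,B)$ satisfying $|A|=|B|+1$. *)

(* Defs.v *)
From HB Require Import structures.
From mathcomp Require Import all_boot.

Set Implicit Arguments.
Unset Strict Implicit.
Unset Printing Implicit Defensive.

(* A finite simple graph is a symmetric irreflexive adjacency relation e on a
   finType T; these two properties are hypotheses of the theorem. *)

Definition independent (T : finType) (e : rel T) (S : {set T}) : bool :=
  [forall x in S, forall y in S, ~~ e x y].

Definition nbhd (T : finType) (e : rel T) (S : {set T}) : {set T} :=
  \bigcup_(v in S) [set u | e v u].

Definition degree (T : finType) (e : rel T) (x : T) : nat := #|[set y | e x y]|.

Definition alpha (T : finType) (e : rel T) : nat :=
  \max_(S : {set T} | independent e S) #|S|.

Definition max_independent (T : finType) (e : rel T) (S : {set T}) : bool :=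
  independent e S && (#|S| == alpha e).

Definition core (T : finType) (e : rel T) : {set T} :=
  \bigcap_(S : {set T} | max_independent e S) S.

Definition corona (T : finType) (e : rel T) : {set T} :=
  \bigcup_(S : {set T} | max_independent e S) S.

Definition bicritical2 (T : finType) (e : rel T) : Prop :=
  forall S : {set T}, S != set0 -> independent e S -> #|S| < #|nbhd e S|.

Definition connected_graph (T : finType) (e : rel T) : Prop :=
  0 < #|T| /\ forall x y : T, connect e x y.

(* A subgraph is a vertex set together with a set of edges, each edge being the
   two-element set of its ends, so that equality of subgraphs is Leibniz
   equality. *)
Definition subgraph (T : finType) : Type := ({set T} * {set {set T}})%type.

Definition verts (T : finType) (H : subgraph T) : {set T} := H.1.
Definition edges (T : finType) (H : subgraph T) : {set {set T}} := H.2.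

Definition whole_graph (T : finType) (e : rel T) : subgraph T :=
  ([set: T], [set [set u.1; u.2] | u : T * T & e u.1 u.2]).

Definition union_graph (T : finType) (H K : subgraph T) : subgraph T :=
  (verts H :|: verts K, edges H :|: edges K).

(* The subgraph traversed by the walk x :: p, which has length size p. *)
Definition walk_graph (T : finType) (x : T) (p : seq T) : subgraph T :=
  ([set:: x :: p], [set:: [seq [set u.1; u.2] | u <- zip (x :: p) p]]).

Definition odd_cycle (T : finType) (e : rel T) (D : subgraph T) : Prop :=
  exists (x : T) (p : seq T),
    [/\ ucycle e (x :: p), 2 < size (x :: p), odd (size (x :: p))
      & D = walk_graph x (rcons p x)].

(* The walk x :: rcons q y has internal vertices q and length (size q).+1.
   The ends of an ear are allowed to coincide. *)
Definition is_ear (T : finType) (e : rel T) (H P : subgraph T) : Prop :=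
  exists (x : T) (q : seq T) (y : T),
    [/\ path e x (rcons q y) /\ odd (size q).+1,
        x \in verts H /\ y \in verts H,
        uniq q,
        (forall z, z \in q -> z \notin verts H)
      & P = walk_graph x (rcons q y)].

(* The pendant with respect to H made of the odd cycle D and of the path P, of
   length l, from D to H. *)
Definition is_pendant (T : finType) (e : rel T) (H D P : subgraph T) (l : nat) :
    Prop :=
  odd_cycle e D /\ [disjoint verts D & verts H] /\
  exists (x : T) (q : seq T) (y : T),
    [/\ path e x (rcons q y) /\ uniq (x :: rcons q y),
        x \in verts D /\ y \in verts H,
        (forall z, z \in q -> z \notin verts H /\ z \notin verts D),
        P = walk_graph x (rcons q y)
      & l = (size q).+1].

Definition two_odd_cycles (T : finType) (e : rel T) (C C' : subgraph T) : Prop :=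
  C <> C' /\ forall D : subgraph T, odd_cycle e D <-> D = C \/ D = C'.

Definition even_linked (T : finType) (e : rel T) : Prop :=
  [/\ connected_graph e,
      bicritical2 e,
      (exists C C' : subgraph T, two_odd_cycles e C C')
    & exists (p : nat) (Gs : nat -> subgraph T),
        [/\ 1 <= p /\ Gs p = whole_graph e,
            odd_cycle e (Gs 0),
            (exists (D P : subgraph T) (l : nat),
               [/\ is_pendant e (Gs 0) D P l, ~~ odd l
                 & Gs 1 = union_graph (Gs 0) (union_graph D P)])
          & forall i : nat, 2 <= i <= p ->
              exists P : subgraph T,
                is_ear e (Gs i.-1) P /\ Gs i = union_graph (Gs i.-1) P]].

Definition cycle_degree2 (T : finType) (e : rel T) (C C' : subgraph T) : {set T} :=
  [set x in verts C :|: verts C' | degree e x == 2].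

(* (A, B) is a bipartition of the subgraph induced by W. *)
Definition bipartition_of (T : finType) (e : rel T) (W A B : {set T}) : Prop :=
  [/\ A :|: B = W, [disjoint A & B], independent e A & independent e B].

(* Main.v *)
(** The two odd cycles C and C' are the initial cycle and that of the pendant,
    hence disjoint. Two connections of C, from different vertices of C, that
    meet outside C would close up to a third odd cycle, so a component K of
    G - C is attached to C at one vertex y only. If K missed C', it would be
    bipartite, and comparing its two colour classes with their neighbourhoods
    (only y lies outside K) contradicts bicriticality. Hence all connections of
    C go to the component of C' and start at one vertex c, the only vertex of C
    of degree other than 2; likewise for c' on C'.

    Put A' = A - {c, c'}; then N(A') is contained in B, and bicriticality with
    |A| = |B| + 1 forces c, c' in A. Now V is the disjoint union of B, A', V(C)
    and V(C'), and an independent set I meets the cycles in at most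
    (|C| - 1)/2 + (|C'| - 1)/2 vertices. If I meets A', then the neighbours of
    I :&: A' outnumber it and are lost from B, so |I :&: (A' :|: B)| <= |B| with
    equality only if B is contained in I. Thus the maximum independent sets
    contain B and miss A = N(B), and B together with either alternating half of
    C - c and of C' - c' is one of them. *)
Require Import Defs.
From HB Require Import structures.
From mathcomp Require Import all_boot.
From mathcomp Require Import zify.

Set Implicit Arguments.
Unset Strict Implicit.

(** * Neighbours of a vertex on a cycle *)

Lemma prev_head (T : eqType) (x : T) (p : seq T) :
  x \notin p -> prev (x :: p) x = last x p.
Proof.
move=> xp; rewrite prev_nth mem_head (memNindex xp).
by rewrite -[RHS]/(last x p) (last_nth x).
Qed.

Lemma next_neq_prev (T : eqType) (s : seq T) (x : T) :
  uniq s -> 2 < size s -> x \in s -> next s x != prev s x.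
Proof.
move=> us sz /rot_to [i p E].
rewrite -(next_rot i us) -(prev_rot i us) E.
move: us sz; rewrite -(rot_uniq i) -(size_rot i s) E => /andP [xp].
rewrite (prev_head xp) next_nth mem_head /= eqxx.
case: p {E xp} => [|y [|z p]] //= /and3P [H _ _] _.
by apply: contraNneq H => ->; apply: mem_last.
Qed.

Lemma degree2_neighbour (T : finType) (e : rel T) (s : seq T) (x y : T) :
  symmetric e -> ucycle e s -> 2 < size s -> x \in s -> degree e x = 2 ->
  e x y -> y = next s x \/ y = prev s x.
Proof.
move=> es /andP [cs us] sz xs d exy.
have E : [set next s x; prev s x] = [set y | e x y].
  apply/eqP; rewrite eqEcard -/(degree e x) d cards2 (next_neq_prev us) // andbT.
  apply/subsetP => z; rewrite !inE => /orP [] /eqP ->; first exact: next_cycle.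
  by rewrite es prev_cycle.
have : y \in [set y | e x y] by rewrite inE.
by rewrite -E !inE => /orP [] /eqP; [left|right].
Qed.

Lemma third_neighbour (T : finType) (e : rel T) (s : seq T) (x : T) :
  symmetric e -> ucycle e s -> 2 < size s -> x \in s -> degree e x != 2 ->
  exists y, [/\ e x y, y != next s x & y != prev s x].
Proof.
move=> es /andP [cs us] sz xs d.
have [] : exists y, y \in [set y | e x y] :\: [set next s x; prev s x].
  apply/set0Pn; apply: contraNneq d => /eqP; rewrite setD_eq0 => sub.
  rewrite -[2]/(true.+1) -(next_neq_prev us sz xs) -cards2; apply/eqP.
  apply/eq_card/subset_eqP/andP; split=> //.
  apply/subsetP => z; rewrite !inE => /orP [] /eqP ->; first exact: next_cycle.
  by rewrite es prev_cycle.
move=> y; rewrite !inE negb_or => /andP [/andP [H1 H2] H3].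
by exists y.
Qed.

(** * Independent sets on an odd cycle *)

Lemma card_set_uniq (T : finType) (s : seq T) : uniq s -> #|[set:: s]| = size s.
Proof. by move/card_uniqP <-; apply: eq_card => v; rewrite inE. Qed.

(** The successor map is injective and carries the part of [I] on the cycle to a set disjoint from
    it, so twice that part fits among an odd number of vertices. *)
Lemma independent_odd_cycle (T : finType) (e : rel T) (s : seq T) (I : {set T}) :
  ucycle e s -> odd (size s) -> independent e I ->
  2 * #|I :&: [set:: s]| < size s.
Proof.
move=> /andP [cs us] os iI.
set J := I :&: _.
have cN : #|[set next s v | v in J]| = #|J|.
  by apply: card_imset; apply: can_inj (prev_next us).
have dN : [disjoint J & [set next s v | v in J]].
  apply/pred0P => v /=; apply/negP => /andP [].
  rewrite !inE => /andP [vI _] /imsetP [w].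
  rewrite !inE => /andP [wI ws] E.
  move/forall_inP/(_ w wI)/forall_inP/(_ v vI): iI.
  by rewrite E next_cycle.
have : #|J :|: [set next s v | v in J]| <= #|[set:: s]|.
  apply/subset_leq_card/subsetP => v; rewrite !inE => /orP [/andP [] //|].
  by case/imsetP => w; rewrite !inE => /andP [_ ws] ->; rewrite mem_next.
rewrite cardsU (disjoint_setI0 dN) cards0 cN (card_set_uniq us).
lia.
Qed.

Lemma index_next (T : eqType) (x y : T) (p : seq T) :
  uniq (x :: p) -> y \in x :: p -> next (x :: p) y \in p ->
  index (next (x :: p) y) p = index y (x :: p).
Proof.
move=> up yp; rewrite next_nth yp => np.
have lt : index y (x :: p) < size p.
  move: up; rewrite ltnNge => /= /andP [xp _].
  apply: contra xp => le; suff E : nth x p (index y (x :: p)) = x by rewrite -E.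
  exact: nth_default.
by rewrite index_uniq //; case/andP: up.
Qed.

(** By the degree condition an edge inside [p] joins consecutive positions, which differ in
    parity. *)
Lemma parity_class_independent (T : finType) (e : rel T) (x : T) (p : seq T)
    (b : bool) :
  symmetric e -> ucycle e (x :: p) -> 2 < size (x :: p) ->
  {in p, forall y, degree e y = 2} ->
  independent e [set y in p | odd (index y p) == b].
Proof.
move=> es cu sz dp; have up : uniq (x :: p) by case/andP: cu.
have key y z : y \in p -> z \in p -> z = next (x :: p) y ->
    index z p = (index y p).+1.
  move=> yp zp E; have : next (x :: p) y \in p by rewrite -E.
  move/(index_next up); rewrite -E => ->; last by rewrite inE yp orbT.
  rewrite /=; case: eqP => // E'; move: up; rewrite /= E' yp //.
apply/forall_inP => y; rewrite inE => /andP [yp /eqP oy].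
apply/forall_inP => z; rewrite inE => /andP [zp /eqP oz].
apply/negP => eyz.
have yxp : y \in x :: p by rewrite inE yp orbT.
case: (degree2_neighbour es cu sz yxp (dp y yp) eyz) => E.
  by move: oz; rewrite (key y z) //= oy; case: b {oy}.
have Ey : y = next (x :: p) z by rewrite E next_prev.
by move: oy; rewrite (key z y zp yp Ey) /= oz; case: b {oz}.
Qed.

(** Complementary halves are provided so that later each vertex of [p] lies in one maximum
    independent set and outside another. *)
Lemma max_independent_odd_cycle (T : finType) (e : rel T) (x : T) (p : seq T) :
  symmetric e -> ucycle e (x :: p) -> 2 < size (x :: p) ->
  odd (size (x :: p)) -> {in p, forall y, degree e y = 2} ->
  exists Y : bool -> {set T},
    [/\ forall b, independent e (Y b), forall b, 2 * #|Y b| = size p,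
        Y true :|: Y false = [set:: p] & [disjoint Y true & Y false]].
Proof.
move=> es cu sz os dp.
pose Y b := [set y in p | odd (index y p) == b].
have iY b : independent e (Y b) by apply: parity_class_independent es cu sz dp.
have YU : Y true :|: Y false = [set:: p].
  by apply/setP => y; rewrite !inE; case: (y \in p) (odd _) => [] [].
have dY : [disjoint Y true & Y false].
  apply/pred0P => y /=; rewrite !inE.
  by case: (y \in p) (odd _) => [] [].
exists Y; split=> //.
(* Each class has at most half of the size, and together they make up p. *)
have cY : #|Y true| + #|Y false| = size p.
  rewrite -cardsUI (disjoint_setI0 dY) cards0 YU addn0.
  by apply: card_set_uniq; case/andP: cu => _ /andP [].
have bY b : 2 * #|Y b| < (size p).+1.
  rewrite -[X in 2 * X](_ : #|Y b :&: [set:: x :: p]| = _).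
    exact: independent_odd_cycle cu os (iY b).
  congr #|pred_of_set _|; apply/setIidPl/subsetP => y; rewrite !inE.
  by case/andP => ->; rewrite orbT.
have [bT bF] := (bY true, bY false).
by move: os => /= os; case; lia.
Qed.

(** * Odd cycles created by ears *)

Lemma ucycle_two_paths (T : eqType) (e : rel T) (x y : T) (p q : seq T) :
  symmetric e -> path e x (rcons p y) -> path e x (rcons q y) ->
  uniq (x :: y :: p ++ q) -> ucycle e (x :: p ++ y :: rev q).
Proof.
move=> es pp pq uq; apply/andP; split.
  rewrite /= rcons_cat /= -cat_rcons cat_path pp last_rcons -rev_cons /=.
  have := rev_path e x (rcons q y).
  rewrite last_rcons belast_rcons => ->.
  by rewrite (eq_path (e' := e)) // => u v /=; rewrite es.
rewrite -(perm_uniq (s1 := x :: y :: p ++ q)) // perm_cons perm_sym.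
by rewrite perm_catC /= perm_cons perm_catC perm_cat2l perm_rev.
Qed.

(** The ends cut the odd cycle into two arcs of different parity, so the ear closes up with one of
    them to an odd cycle. The last hypothesis excludes an ear that is an edge of the cycle. *)
Lemma odd_cycle_ear (T : finType) (e : rel T) (s q : seq T) (x y : T) :
  symmetric e -> ucycle e s -> odd (size s) -> x \in s -> y \in s -> x != y ->
  path e x (rcons q y) -> uniq q -> {in q, forall z, z \notin s} ->
  (q != [::]) || (y != next s x) && (y != prev s x) ->
  exists t : seq T,
    [/\ ucycle e t, 2 < size t, odd (size t), x \in t
      & [set:: t] != [set:: s]].
Proof.
move=> es /andP [cs us] os xs ys xy pq uq dq nd.
have [i p E] := rot_to xs.
have yp : y \in p.
  by move: ys; rewrite -(mem_rot i) E inE eq_sym (negPf xy).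
rewrite -(next_rot i us) -(prev_rot i us) E in nd.
rewrite -(size_rot i) E in os.
rewrite -(rot_uniq i) E in us.
rewrite -(rot_cycle i) E in cs.
have ms z : (z \in s) = (z \in x :: p) by rewrite -(mem_rot i) E.
have dq' z : z \in q -> z \notin x :: p by move=> zq; rewrite -ms dq.
have sE : [set:: s] = [set:: x :: p] by apply/setP => z; rewrite inE ms inE.
rewrite {}sE; move: {E xs ys ms dq} os us cs nd dq'.
case/splitPr: p / yp => p1 p2 os us cs nd dq.
have [c1 c2] : path e x (rcons p1 y) /\ path e x (rcons (rev p2) y).
  move: cs; rewrite /= rcons_cat /= -cat_rcons cat_path last_rcons => /andP [-> H].
  split=> //; rewrite -rev_cons.
  have := rev_path e y (rcons p2 x).
  rewrite last_rcons belast_rcons => ->.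
  by rewrite (eq_path (e' := e)) // => u v /=; rewrite es.
have up : perm_eq (x :: p1 ++ y :: p2) (x :: y :: p1 ++ p2).
  by rewrite perm_cons perm_catC /= perm_cons perm_catC.
rewrite (perm_uniq up) in us.
have dq' z : z \in q -> z \notin x :: y :: p1 ++ p2.
  by move/dq; rewrite (perm_mem up).
have dU : uniq ((x :: y :: p1 ++ p2) ++ q).
  rewrite cat_uniq us uq andbT.
  by apply/hasPn.
have u1 : uniq (x :: y :: p1 ++ q).
  apply: subseq_uniq dU; rewrite /= !eqxx -catA cat_subseq //.
  exact: suffix_subseq.
have u2 : uniq (x :: y :: rev p2 ++ q).
  rewrite -(perm_uniq (s1 := x :: y :: p2 ++ q)); last first.
    by rewrite !perm_cons perm_cat2r perm_sym perm_rev.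
  apply: subseq_uniq dU; rewrite /= !eqxx -catA.
  exact: suffix_subseq.
(* The new vertex set is told apart by an internal vertex of the ear or, for a chord, by an omitted
   internal vertex of the other arc. *)
have new t : x \in t -> {subset q <= t} ->
    (q = [::] -> exists2 z, z \in p1 ++ p2 & z \notin t) ->
    [set:: t] != [set:: x :: p1 ++ y :: p2].
  move=> xt qt; case: (q =P [::]) => [-> /(_ erefl) [z zp zt] | + _].
    apply: contraNneq zt => /setP /(_ z).
    by rewrite !inE => ->; move: zp; rewrite !mem_cat inE => /orP [] -> ; rewrite !orbT.
  case: q qt dq {pq uq nd dq' dU u1 u2} => // z q qt dq _.
  have := dq z (mem_head _ _); apply: contraNneq => /setP /(_ z).
  by rewrite !inE => <-; apply: qt; rewrite mem_head.
have p10 : q = [::] -> p1 != [::].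
  move=> q0; move: nd; rewrite q0 eqxx orFb => /andP [+ _].
  by rewrite next_nth mem_head /= eqxx; case: (p1); rewrite ?eqxx.
have p20 : q = [::] -> p2 != [::].
  move=> q0; move: nd; rewrite q0 eqxx orFb => /andP [_].
  have xp : x \notin p1 ++ y :: p2.
    by move: us => /= /andP [+ _]; rewrite !(inE, mem_cat) orbCA.
  by rewrite (prev_head xp) last_cat; case: (p2); rewrite ?eqxx.
have [d1 d2] : {in p2, forall z, z \notin x :: p1 ++ [:: y]} /\
               {in p1, forall z, z \notin x :: rev p2 ++ [:: y]}.
  move: us => /= /and3P [xN yN]; rewrite cat_uniq => /and3P [_ /hasPn D _].
  split=> z zp; rewrite !(inE, mem_cat) ?mem_rev; apply/negP => /or3P [/eqP zx||/eqP zy].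
  - by move: xN; rewrite !(inE, mem_cat) -zx zp !orbT.
  - by apply/negP/(D z).
  - by move: yN; rewrite !(inE, mem_cat) -zy zp !orbT.
  - by move: xN; rewrite !(inE, mem_cat) -zx zp !orbT.
  - by move=> zp2; have /negP := D z zp2.
  - by move: yN; rewrite !(inE, mem_cat) -zy zp.
(* The ear and the arc [p1] form a cycle on [size p1 + size q + 2] vertices. As [size p1 + size p2]
   is odd, [p2] serves when [p1] does not. *)
have [O|O] := boolP (odd (size p1 + size q)).
  exists (x :: p1 ++ y :: rev q); rewrite /= size_cat /= size_rev.
  split; rewrite ?mem_head //; first exact: ucycle_two_paths.
  - by rewrite addnS !ltnS; case: (_ + _) O.
  - by rewrite addnS /= negbK.
  apply: new; rewrite ?mem_head //.
    by move=> z zq; rewrite !(inE, mem_cat) mem_rev zq !orbT.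
  move=> q0; case: (p2) d1 (p20 q0) => // z r /(_ z (mem_head _ _)) zN _.
  by exists z; rewrite ?q0 // mem_cat mem_head orbT.
have O' : odd (size p2 + size q).
  move: O os; rewrite /= size_cat /= addnS /= negbK !oddD.
  by case: (odd (size p1)) (odd (size p2)) (odd (size q)) => [] [] [].
exists (x :: rev p2 ++ y :: rev q); rewrite /= size_cat /= !size_rev.
split; rewrite ?mem_head //; first exact: ucycle_two_paths.
- by rewrite addnS !ltnS; case: (_ + _) O'.
- by rewrite addnS /= negbK.
apply: new; rewrite ?mem_head //.
  by move=> z zq; rewrite !(inE, mem_cat) !mem_rev zq !orbT.
move=> q0; case: (p1) d2 (p10 q0) => // z r /(_ z (mem_head _ _)) zN _.
by exists z; rewrite ?q0 // mem_head.
Qed.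

(** * Independence and neighbourhood counts *)

Lemma independentW (T : finType) (e : rel T) (I : {set T}) (u v : T) :
  independent e I -> u \in I -> v \in I -> ~~ e u v.
Proof. by move=> /forall_inP iI /iI /forall_inP H /H. Qed.

Lemma independentS (T : finType) (e : rel T) (I J : {set T}) :
  J \subset I -> independent e I -> independent e J.
Proof.
move=> /subsetP JI iI; apply/forall_inP => u /JI uI; apply/forall_inP => v /JI.
exact: independentW.
Qed.

Lemma nbhd_subset (T : finType) (e : rel T) (S R : {set T}) :
  (forall u v, u \in S -> e u v -> v \in R) -> nbhd e S \subset R.
Proof.
move=> H; apply/bigcupsP => u uS; apply/subsetP => v; rewrite inE.
exact: H.
Qed.

Lemma bicritical_card (T : finType) (e : rel T) (S R : {set T}) :
  bicritical2 e -> independent e S -> S != set0 ->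
  (forall u v, u \in S -> e u v -> v \in R) -> #|S| < #|R|.
Proof.
move=> bc iS S0 /nbhd_subset /subset_leq_card; apply: leq_trans.
exact: bc.
Qed.

(* With P and Q the parts of K in B and A, bicriticality gives both
   |P| <= |Q| and |Q| < |P|. *)
Lemma no_bipartite_pendant_part (T : finType) (e : rel T) (K A B : {set T})
    (y w : T) :
  bicritical2 e -> independent e A -> independent e B -> K \subset A :|: B ->
  y \in A -> w \in K -> e y w ->
  (forall z v, z \in K -> e z v -> v \in y |: K) -> False.
Proof.
move=> bc iA iB /subsetP KAB yA wK yw cK.
have KN z v : z \in K -> v \in K -> e z v -> (v \in A) = (z \notin A).
  move=> zK vK zv; apply/idP/idP => [vA|zA].
    by apply: contraTN zv => zA; apply: independentW iA zA vA.
  apply: contraTT zv => vA; apply: independentW iB _ _.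
    by have := KAB z zK; rewrite inE (negPf zA).
  by have := KAB v vK; rewrite inE (negPf vA).
have wA : w \notin A.
  by apply: contraTN yw => wA; apply: independentW iA yA wA.
have iQ : independent e (K :&: A) by apply: independentS iA; apply: subsetIr.
have iP : independent e (K :\: A).
  apply: independentS iB; apply/subsetP => z; rewrite inE => /andP [zA /KAB].
  by rewrite inE (negPf zA).
(* Neighbours of [K :\: A] lie in [K :&: A] or equal [y]; this one extra vertex weakens the strict
   bound to [<=]. *)
have lP : #|K :\: A| < #|y |: (K :&: A)|.
  apply: bicritical_card bc iP _ _; first by apply/set0Pn; exists w; rewrite inE wA.
  move=> z v; rewrite !inE => /andP [zA zK] zv.
  have := cK z v zK zv; rewrite !inE; case: eqP => //= _ vK.
  by rewrite vK (KN z v).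
have {}lP : #|K :\: A| <= #|K :&: A|.
  by move: lP; rewrite cardsU1; case: (y \notin _) => //= /ltnW.
(* In this direction [y] does not count, since it lies in [A] and so has no neighbour in
   [K :&: A]. *)
suff : #|K :&: A| < #|K :\: A| by rewrite ltnNge lP.
apply: bicritical_card bc iQ _ _.
  rewrite -card_gt0; apply: leq_trans lP; rewrite card_gt0.
  by apply/set0Pn; exists w; rewrite inE wA.
move=> z v; rewrite inE => /andP [zK zA] zv.
have vA : v \notin A by apply: contraTN zv => vA; apply: independentW iA zA vA.
rewrite inE vA; have := cK z v zK zv; rewrite !inE => /orP [/eqP E|//].
by rewrite E yA in vA.
Qed.

(** * Attachment of an odd cycle to the rest of the graph *)

Definition only_odd_cycles (T : finType) (e : rel T) (s s' : seq T) : Prop :=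
  forall t : seq T, ucycle e t -> 2 < size t -> odd (size t) ->
    [set:: t] = [set:: s] \/ [set:: t] = [set:: s'].

(** The odd cycle produced by the ear contains [x], so its vertex set is not that of the disjoint
    [s'], and it differs from that of [s]. *)
Lemma no_ear (T : finType) (e : rel T) (s s' q : seq T) (x y : T) :
  symmetric e -> ucycle e s -> odd (size s) ->
  {in s, forall z, z \notin s'} -> only_odd_cycles e s s' ->
  x \in s -> y \in s -> x != y ->
  path e x (rcons q y) -> uniq q -> {in q, forall z, z \notin s} ->
  (q != [::]) || (y != next s x) && (y != prev s x) -> False.
Proof.
move=> es cs os ds H xs ys xy pq uq dq nd.
have [t [ct st ot xt /eqP nt]] := odd_cycle_ear es cs os xs ys xy pq uq dq nd.
case: (H t ct st ot) => // /setP /(_ x); rewrite !inE xt => /esym xs'.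
by have := ds x xs; rewrite xs'.
Qed.

Lemma outside_neighbour (T : finType) (e : rel T) (s s' : seq T) (x : T) :
  symmetric e -> irreflexive e -> ucycle e s -> 2 < size s -> odd (size s) ->
  {in s, forall z, z \notin s'} -> only_odd_cycles e s s' ->
  x \in s -> degree e x != 2 -> exists2 u, e x u & u \notin s.
Proof.
move=> es ei cs sz os ds H xs d.
have [u [xu n1 n2]] := third_neighbour es cs sz xs d.
exists u => //; apply/negP => us.
apply: (@no_ear _ e s s' [::] x u) => //=.
- by apply: contraTneq xu => ->; rewrite ei.
- by rewrite xu.
by rewrite n1 n2.
Qed.

(** Adjacency in G - V(s), kept on the type [T]: vertices of [s] become isolated, and [connect] from
    outside [s] yields the components of G - V(s). *)
Definition off_cycle (T : finType) (e : rel T) (s : seq T) : rel T :=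
  [rel a b | [&& e a b, a \notin s & b \notin s]].

Lemma off_cycle_connect_sym (T : finType) (e : rel T) (s : seq T) :
  symmetric e -> connect_sym (off_cycle e s).
Proof.
move=> es; apply: sym_connect_sym => a b; rewrite /off_cycle /= es.
by case: (a \notin s) (b \notin s) => [] [].
Qed.

Lemma connect_off_cycle (T : finType) (e : rel T) (s : seq T) (w z : T) :
  symmetric e -> w \notin s -> connect (off_cycle e s) w z -> z \notin s.
Proof.
move=> es ws; move/(closed_connect (a := [predC s])); rewrite !inE => <- //.
by apply: (intro_closed (off_cycle_connect_sym s es)) => a b /and3P [].
Qed.

(** The connection from [u] to [w], shortened to a simple path, is the interior of an ear from [x]
    to [y]. *)
Lemma no_detour (T : finType) (e : rel T) (s s' : seq T) (x y u w : T) :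
  symmetric e -> ucycle e s -> odd (size s) ->
  {in s, forall z, z \notin s'} -> only_odd_cycles e s s' ->
  x \in s -> y \in s -> x != y -> e x u -> e y w -> u \notin s ->
  connect (off_cycle e s) u w -> False.
Proof.
move=> es cs os ds H xs ys xy xu yw us /connectP [q0 p0 E0].
move: E0; case/shortenP: p0 => q pq uq _ E.
have dq : {in u :: q, forall z, z \notin s}.
  by move=> z zq; apply: (connect_off_cycle es us (path_connect pq zq)).
apply: (@no_ear _ e s s' (u :: q) x y) => //=.
rewrite xu rcons_path -E es yw andbT.
by apply: sub_path pq => a b /and3P [].
Qed.

(** Otherwise the component of [w] off [s] avoids [s'], so it is bipartite, and by [no_detour] it is
    attached to [s] at [y] alone; bicriticality forbids this. *)
Lemma pendant_component (T : finType) (e : rel T) (s s' : seq T)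
    (A B : {set T}) (y w : T) :
  symmetric e -> bicritical2 e -> ucycle e s -> odd (size s) ->
  {in s, forall z, z \notin s'} -> only_odd_cycles e s s' ->
  independent e A -> independent e B ->
  (forall z, z \notin s -> z \notin s' -> z \in A :|: B) ->
  y \in s -> y \in A :|: B -> e y w -> w \notin s ->
  exists2 z, z \in s' & connect (off_cycle e s) w z.
Proof.
move=> es bc cs os ds H iA iB cAB ys yAB yw ws.
case: (pickP [pred z in s' | connect (off_cycle e s) w z]) => [z /andP [] | nK].
  by exists z.
exfalso.
pose K := [set z | connect (off_cycle e s) w z].
have KAB : K \subset A :|: B.
  apply/subsetP => z; rewrite inE => wz; apply: cAB.
    exact: connect_off_cycle wz.
  by have /negbT := nK z; rewrite inE wz andbT.
have wK : w \in K by rewrite inE connect0.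
have cK z v : z \in K -> e z v -> v \in y |: K.
  rewrite !inE => wz zv; case: (eqVneq v y) => //= vy.
  have zs := connect_off_cycle es ws wz.
  case vs : (v \in s).
    by case: (@no_detour _ e s s' y v w z) => //; rewrite // 1?eq_sym // es.
  by apply: connect_trans wz (connect1 _); rewrite /off_cycle /= zv zs vs.
move: yAB; rewrite inE => /orP [yA|yB].
  exact: (no_bipartite_pendant_part bc iA iB KAB yA wK yw cK).
rewrite setUC in KAB.
exact: (no_bipartite_pendant_part bc iB iA KAB yB wK yw cK).
Qed.

(** Outside neighbours of [x] and of [y] both reach [s'], which is connected and lies off [s];
    joined along [s'], the two connections would form a detour. *)
Lemma unique_attachment (T : finType) (e : rel T) (s s' : seq T)
    (A B : {set T}) (x y : T) :
  symmetric e -> irreflexive e -> bicritical2 e ->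
  ucycle e s -> 2 < size s -> odd (size s) -> ucycle e s' ->
  {in s, forall z, z \notin s'} -> only_odd_cycles e s s' ->
  independent e A -> independent e B ->
  (forall z, z \notin s -> z \notin s' -> z \in A :|: B) ->
  {in s, forall z, degree e z != 2 -> z \in A :|: B} ->
  x \in s -> y \in s -> degree e x != 2 -> degree e y != 2 -> x = y.
Proof.
move=> es ei bc cs sz os cs' ds H iA iB cAB dAB xs ys dx dy.
case: (eqVneq x y) => // xy; exfalso.
have [u xu us] := outside_neighbour es ei cs sz os ds H xs dx.
have [w yw ws] := outside_neighbour es ei cs sz os ds H ys dy.
have [a as' ua] := pendant_component es bc cs os ds H iA iB cAB xs (dAB x xs dx) xu us.
have [b bs' wb] := pendant_component es bc cs os ds H iA iB cAB ys (dAB y ys dy) yw ws.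
apply: (no_detour es cs os ds H xs ys xy xu yw us).
apply: connect_trans ua _; rewrite (off_cycle_connect_sym s es).
apply: connect_trans wb _; move: as' bs'; case/andP: cs' => cs' _ as' bs'.
have ds' z : z \in s' -> z \notin s by move=> zs'; apply: contraTN zs'; apply: ds.
apply: (connect_cycle (p := s')) => //.
apply: (sub_in_cycle (P := mem s') (e := e)) cs'; last exact/allP.
by move=> c d /= /ds' cs1 /ds' ds1 cd; rewrite /off_cycle /= cd cs1 ds1.
Qed.

(** If all of [s] had degree 2, [s] would be closed under adjacency, and connectedness would leave
    no room for [s']. So an attachment vertex exists; it is unique, and a rotation brings it to the
    front. *)
Lemma attached_cycle (T : finType) (e : rel T) (s s' : seq T)
    (A B : {set T}) :
  symmetric e -> irreflexive e -> (forall a b, connect e a b) ->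
  bicritical2 e -> ucycle e s -> 2 < size s -> odd (size s) ->
  ucycle e s' -> s' != [::] ->
  {in s, forall z, z \notin s'} -> only_odd_cycles e s s' ->
  independent e A -> independent e B ->
  (forall z, z \notin s -> z \notin s' -> z \in A :|: B) ->
  {in s, forall z, degree e z != 2 -> z \in A :|: B} ->
  exists (c : T) (p : seq T),
    [/\ ucycle e (c :: p), 2 < size (c :: p) /\ odd (size (c :: p)),
        s =i c :: p, degree e c != 2 & {in p, forall y, degree e y = 2}].
Proof.
move=> es ei conn bc cs sz os cs' s'0 ds H iA iB cAB dAB.
have [c cs0 dc] : exists2 c, c \in s & degree e c != 2.
  case: (pickP [pred z in s | degree e z != 2]) => [z /andP [] | ns].
    by exists z.
  have d2 z : z \in s -> degree e z = 2.
    by move=> zs; have := ns z; rewrite inE /= zs => /negbFE/eqP.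
  have cl : closed e (mem s).
    apply: intro_closed => [|u v uv us]; first exact: sym_connect_sym.
    by case: (degree2_neighbour es cs sz us (d2 u us) uv) => ->;
      rewrite ?mem_next ?mem_prev.
  case: s' s'0 ds {cs' H cAB} => // b r _ ds.
  case: s sz {cs os ns dAB d2} ds cl => // a q _ ds cl.
  have ba : b \in a :: q by rewrite -(closed_connect cl (conn a b)) mem_head.
  by have := ds b ba; rewrite mem_head.
have [i p E] := rot_to cs0.
have ms z : (z \in s) = (z \in c :: p) by rewrite -(mem_rot i) E.
exists c, p; rewrite -E rot_ucycle size_rot; split=> // z.
  by rewrite mem_rot.
move=> zp; apply/eqP; apply: contraTT zp => dz.
apply/negP => zp.
have zs : z \in s by rewrite ms inE zp orbT.
have zc := unique_attachment es ei bc cs sz os cs' ds H iA iB cAB dAB zs cs0 dz dc.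
have : uniq (c :: p) by rewrite -E rot_uniq; case/andP: cs.
by rewrite /= -zc zp.
Qed.

(** * The maximum independent sets and their core and corona *)

Lemma independentU (T : finType) (e : rel T) (S R : {set T}) :
  symmetric e -> independent e S -> independent e R ->
  (forall u v, u \in S -> v \in R -> ~~ e u v) -> independent e (S :|: R).
Proof.
move=> es iS iR SR; apply/forall_inP => u uU; apply/forall_inP => v.
move: uU; rewrite !inE => /orP [] uU /orP [] vU.
- exact: independentW iS uU vU.
- exact: SR.
- by rewrite es; apply: SR.
exact: independentW iR uU vU.
Qed.

(** Both sides are assumed nonempty because [partition] admits no empty block. *)
Lemma partition_setC (T : finType) (A : {set T}) :
  A != set0 -> ~: A != set0 ->
  partition [set ~: A; A] [set: T] /\ [disjoint ~: A & A].
Proof.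
move=> A0 CA0; have dA : [disjoint ~: A & A] by rewrite disjoints_subset.
split=> //; apply/and3P; split.
- apply/eqP/setP => z; rewrite in_setT; apply/bigcupP.
  case zA : (z \in A); first by exists A; rewrite ?inE ?eqxx ?orbT.
  by exists (~: A); rewrite ?inE ?eqxx ?zA.
- apply/trivIsetP => X Y; rewrite !inE.
  by case/orP=> /eqP -> /orP [] /eqP ->; rewrite ?eqxx // disjoint_sym.
by rewrite !inE !(eq_sym set0) negb_or CA0.
Qed.

Ltac card_lia :=
  clear; repeat match goal with |- context [#|?S|] => move: #|S| end;
  repeat match goal with |- context [size ?p] => move: (size p) end; lia.

Lemma two_attached_cycles (T : finType) (e : rel T) (c c' : T) (p p' : seq T)
    (A B : {set T}) :
  symmetric e -> bicritical2 e ->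
  ucycle e (c :: p) -> 2 < size (c :: p) -> odd (size (c :: p)) ->
  {in p, forall y, degree e y = 2} ->
  ucycle e (c' :: p') -> 2 < size (c' :: p') -> odd (size (c' :: p')) ->
  {in p', forall y, degree e y = 2} ->
  {in c :: p, forall z, z \notin c' :: p'} ->
  bipartition_of e (~: ([set:: p] :|: [set:: p'])) A B -> #|A| = #|B| + 1 ->
  [/\ #|corona e| + #|core e| = 2 * alpha e, nbhd e (core e) = A
    & corona e = ~: A].
Proof.
move=> es bc cs sz os dp cs' sz' os' dp' ds [AB dAB iA iB] cAB.
have ABE z : (z \in A) || (z \in B) = (z \notin p) && (z \notin p').
  by have /setP/(_ z) := AB; rewrite !inE negb_or.
have cp : c \notin p by case/andP: cs => _ /andP [].
have cp' : c' \notin p' by case/andP: cs' => _ /andP [].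
have pp' z : z \in p -> z \notin c' :: p' by move=> zp; rewrite ds // inE zp orbT.
have p'p z : z \in p' -> z \notin c :: p.
  by move=> zp'; apply: contraTN zp' => /ds; rewrite inE negb_or => /andP [].
have cN' : c \notin c' :: p' by rewrite ds ?mem_head.
have cc' : c != c' by move: cN'; rewrite inE negb_or => /andP [].
have cAB0 : (c \in A) || (c \in B).
  by rewrite ABE cp; move: cN'; rewrite inE negb_or => /andP [].
have c'p : c' \notin p by apply: contraT => /negPn /pp'; rewrite mem_head.
have cAB' : (c' \in A) || (c' \in B) by rewrite ABE cp' c'p.
have Np z v : z \in p -> e z v -> v \in c :: p.
  move=> zp zv; have zs : z \in c :: p by rewrite inE zp orbT.
  by case: (degree2_neighbour es cs sz zs (dp z zp) zv) => ->;
    rewrite ?mem_next ?mem_prev.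
have Np' z v : z \in p' -> e z v -> v \in c' :: p'.
  move=> zp zv; have zs : z \in c' :: p' by rewrite inE zp orbT.
  by case: (degree2_neighbour es cs' sz' zs (dp' z zp) zv) => ->;
    rewrite ?mem_next ?mem_prev.
(* Vertices of [p] and [p'] have all their neighbours on their own cycle, so within [A :|: B] only
   [c] and [c'] can be adjacent to them. *)
have NAB z v : (z \in A) || (z \in B) -> z \notin [set c; c'] -> e z v ->
    (v \in A) || (v \in B).
  rewrite !ABE !inE negb_or => /andP [zp zp'] /andP [zc zc'] zv.
  apply/andP; split.
    by apply: contraTN zv => vp; rewrite es; apply/negP => /(Np _ _ vp);
      rewrite inE (negPf zc) (negPf zp).
  by apply: contraTN zv => vp; rewrite es; apply/negP => /(Np' _ _ vp);
    rewrite inE (negPf zc') (negPf zp').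
pose A' := A :\: [set c; c'].
have NA z v : z \in A' -> e z v -> v \in B.
  rewrite inE => /andP [zc zA] zv.
  have := NAB z v; rewrite zA => /(_ isT zc zv) /orP [vA|//].
  by have := independentW iA zA vA; rewrite zv.
have iA' : independent e A' by apply: independentS iA; apply: subsetDl.
have A'B : A' != set0 -> #|A'| < #|B| by move=> A0; apply: bicritical_card NA.
have cardA' : #|A :&: [set c; c']| + #|A'| = #|A| by apply: cardsID.
(* Otherwise [A'] has at least |A| - 1 = |B| elements, which bicriticality allows only if [A'] is
   empty; then |A| <= 1, so [B] is empty and [c], [c'] can lie only in [A]. *)
have /andP [cA c'A] : (c \in A) && (c' \in A).
  apply: contraT => nA.
  have l1 : #|A :&: [set c; c']| <= 1.
    have sub : A :&: [set c; c'] \proper [set c; c'].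
      rewrite properEneq subsetIr andbT; apply: contraNneq nA => E.
      move/setP: E => E; have := E c; have := E c'.
      by rewrite !inE !eqxx ?orbT !andbT => -> ->.
    by have := proper_card sub; rewrite cards2 cc'.
  have A0 : A' = set0.
    by apply/eqP; apply: contraT => /A'B; move: l1 cardA' cAB; card_lia.
  have B0 : #|B| = 0 by move: cardA' l1; rewrite A0 cards0; move: cAB; card_lia.
  move: nA cAB0 cAB'; rewrite (cards0_eq B0) !inE !orbF => /negP nA cA c'A.
  by case: nA; rewrite cA c'A.
have cN : #|B| = #|A'|.+1.
  have E : A :&: [set c; c'] = [set c; c'].
    by apply/setIidPr/subsetP => z; rewrite !inE => /orP [] /eqP ->.
  by move: cardA'; rewrite E cards2 cc' cAB; card_lia.
have B0 : B != set0 by rewrite -card_gt0 cN.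
have nAB z : z \in A -> z \notin B.
  by move=> zA; rewrite (disjointFr dAB zA).
have NB z v : z \in B -> e z v -> v \in A.
  move=> zB zv; have zc : z \notin [set c; c'].
    by rewrite !inE; apply: contraTN zB => /orP [] /eqP ->; apply: nAB.
  have := NAB z v; rewrite zB orbT => /(_ isT zc zv) /orP [//|vB].
  by have := independentW iB zB vB; rewrite zv.
(* By bicriticality N(B) has at least |B| + 1 = |A| elements, so its inclusion in [A] is an
   equality. *)
have NBA : nbhd e B = A.
  apply/eqP; rewrite eqEcard (nbhd_subset NB) /= cAB addn1.
  exact: bc.
have [Y [iY cY YU dY]] := max_independent_odd_cycle es cs sz os dp.
have [Y' [iY' cY' YU' dY']] := max_independent_odd_cycle es cs' sz' os' dp'.
have Yp b z : z \in Y b -> z \in p.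
  by move=> zY; have /setP/(_ z) := YU; rewrite !inE => <-; case: b zY => ->;
    rewrite ?orbT.
have Yp' b z : z \in Y' b -> z \in p'.
  by move=> zY; have /setP/(_ z) := YU'; rewrite !inE => <-; case: b zY => ->;
    rewrite ?orbT.
have Bp z : z \in B -> (z \notin p) && (z \notin p') by rewrite -ABE => ->; rewrite orbT.
have Bc z : z \in B -> (z != c) && (z != c').
  by move=> zB; apply/andP; split; apply: contraTneq zB => ->; apply: nAB.
pose J b := B :|: (Y b :|: Y' b).
have iJ b : independent e (J b).
  apply: independentU => //; first apply: independentU => // u v.
    move=> /Yp up /Yp' vp'; apply/negP => /(Np _ _ up).
    by apply/negP/p'p.
  move=> u v uB; rewrite inE es => /orP [/Yp vp | /Yp' vp]; apply/negP.
    move/(Np _ _ vp); have /andP [up _] := Bp u uB; have /andP [uc _] := Bc u uB.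
    by rewrite inE (negPf up) (negPf uc).
  move/(Np' _ _ vp); have /andP [_ up] := Bp u uB; have /andP [_ uc] := Bc u uB.
  by rewrite inE (negPf up) (negPf uc).
have card3 (S R : {set T}) : {subset S <= p} -> {subset R <= p'} ->
    #|B :|: (S :|: R)| = #|B| + (#|S| + #|R|).
  move=> Sp Rp; rewrite !cardsU.
  have -> : S :&: R = set0.
    apply/eqP; rewrite setI_eq0; apply/pred0P => z /=; apply/negP => /andP [zS zR].
    by have := pp' z (Sp z zS); rewrite inE (Rp z zR) orbT.
  have -> : B :&: (S :|: R) = set0.
    apply/eqP; rewrite setI_eq0; apply/pred0P => z /=; apply/negP => /andP [zB].
    have /andP [zp zp'] := Bp z zB.
    by rewrite inE => /orP [/Sp | /Rp]; apply/negP.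
  by rewrite !cards0 !subn0.
have cJ b : 2 * #|J b| = 2 * #|B| + (size p + size p').
  by rewrite (card3 _ _ (@Yp b) (@Yp' b)) -(cY b) -(cY' b); card_lia.
(* This is twice the independence number; the doubling avoids halving [size p] and [size p']. *)
set K := 2 * #|B| + (size p + size p') in cJ.
have key I : independent e I -> 2 * #|I| <= K /\ (K <= 2 * #|I| -> B \subset I).
  move=> iI.
  have lI : #|I| <= #|I :&: B| + #|I :&: A'| +
                    (#|I :&: [set:: c :: p]| + #|I :&: [set:: c' :: p']|).
    apply: (@leq_trans #|(I :&: B :|: I :&: A') :|:
        (I :&: [set:: c :: p] :|: I :&: [set:: c' :: p'])|).
      apply/subset_leq_card/subsetP => z zI; rewrite !inE zI /= !orbA.
      have := ABE z; case: (z \in A) (z \in B) (z \in p) (z \in p') => [] [] [] [];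
        by rewrite /= ?orbT // ?andbT; case: (z == c) (z == c') => [] [].
    apply: (leq_trans (leq_card_setU _ _).1).
    by apply: leq_add; apply: (leq_card_setU _ _).1.
  have l1 := independent_odd_cycle cs os iI.
  have l2 := independent_odd_cycle cs' os' iI.
  have BI : #|B :&: I| + #|B :\: I| = #|B| := cardsID I B.
  rewrite setIC in BI.
  have [IA'|IA'] := eqVneq (I :&: A') set0.
    rewrite IA' cards0 in lI; move: l1 l2 => /= l1 l2; split.
      by rewrite /K; move: lI l1 l2 BI; card_lia.
    move=> lK; rewrite -setD_eq0 -cards_eq0.
    by move: lK lI l1 l2 BI; rewrite /K; card_lia.
  (* The neighbours of [I :&: A'] lie in [B] and avoid [I]. They outnumber it, so [2 * #|I|] stays
     below [K] and equality is impossible. *)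
  have l3 : #|I :&: A'| < #|B :\: I|.
    apply: bicritical_card bc _ IA' _.
      by apply: independentS iI; apply: subsetIl.
    move=> u v; rewrite inE => /andP [uI uA'] uv; rewrite inE (NA u v uA' uv) andbT.
    by apply: contraTN uv => vI; apply: independentW iI uI vI.
  move: l1 l2 => /= l1 l2; split.
    by rewrite /K; move: lI l1 l2 l3 BI; card_lia.
  by move=> lK; exfalso; move: lK lI l1 l2 l3 BI; rewrite /K; card_lia.
have alphaE : 2 * alpha e = K.
  apply/eqP; rewrite eqn_leq; apply/andP; split; last first.
    rewrite -(cJ true) leq_pmul2l //.
    exact: (leq_bigmax_cond (F := fun S : {set T} => #|S|)) (iJ true).
  have hK : K = 2 * #|J true| by rewrite cJ.
  rewrite hK leq_pmul2l //; apply/bigmax_leqP => I /key [].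
  by rewrite hK leq_pmul2l.
have mJ b : max_independent e (J b).
  by rewrite /max_independent iJ /= -(eqn_pmul2l (m := 2)) // cJ alphaE.
have BM I : max_independent e I -> B \subset I.
  by move=> /andP [/key [_ H] /eqP E]; apply: H; rewrite E alphaE.
(* A core vertex outside [B] would lie in cycle halves of both [J true] and [J false], but these are
   disjoint. *)
have coreE : core e = B.
  apply/eqP; rewrite eqEsubset; apply/andP; split; last exact/bigcapsP.
  apply/subsetP => z /bigcapP zc; apply: contraT => zB.
  have := (zc _ (mJ true), zc _ (mJ false)); rewrite !inE (negPf zB) /=.
  case=> /orP [] zT /orP [] zF.
  - by rewrite (disjointFr dY zT) in zF.
  - by have := pp' z (Yp _ _ zT); rewrite inE (Yp' _ _ zF) orbT.
  - by have := pp' z (Yp _ _ zF); rewrite inE (Yp' _ _ zT) orbT.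
  - by rewrite (disjointFr dY' zT) in zF.
have CAE : ~: A = B :|: ([set:: p] :|: [set:: p']).
  apply/setP => z; rewrite !inE; have := ABE z; have := nAB z.
  case: (z \in A) (z \in B) (z \in p) (z \in p') => [] [] [] [] //=;
    by move/(_ isT).
(* Every vertex of [A] = N(B) has a neighbour in [B], hence in each maximum independent set;
   conversely [J true] and [J false] cover the complement of [A]. *)
have coronaE : corona e = ~: A.
  apply/eqP; rewrite eqEsubset; apply/andP; split.
    apply/bigcupsP => I mI; apply/subsetP => a aI; rewrite inE.
    apply/negP => aA; move: (aA); rewrite -NBA => /bigcupP [b bB]; rewrite inE.
    have bI := subsetP (BM I mI) b bB.
    by apply/negP; apply: independentW bI aI; case/andP: mI.
  rewrite CAE -YU -YU'; apply/subsetP => z; rewrite !inE => zU.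
  have [b zJ] : exists b, z \in J b.
    move: zU; rewrite /J => /or3P [zB | /orP [] zY | /orP [] zY];
      by [exists true; rewrite !inE ?zB ?zY ?orbT
         | exists false; rewrite !inE ?zB ?zY ?orbT].
  by apply/bigcupP; exists (J b).
rewrite coreE coronaE NBA; split=> //.
have up : uniq p by case/andP: cs => _ /andP [].
have up' : uniq p' by case/andP: cs' => _ /andP [].
(* The corona has |B| + [size p] + [size p'] elements and the core |B|, which add up to [K]. *)
rewrite alphaE CAE card3 ?card_set_uniq //; try by move=> z; rewrite inE.
by rewrite /K; card_lia.
Qed.

(** * From subgraphs to vertex sequences, and the theorem *)

Lemma odd_cycle_verts (T : finType) (e : rel T) (D : subgraph T) :
  odd_cycle e D -> exists s : seq T,
    [/\ ucycle e s, 2 < size s, odd (size s) & verts D = [set:: s]].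
Proof.
move=> [x [p [cp sz op ->]]]; exists (x :: p); split=> //.
by apply/setP => z; rewrite !(inE, mem_rcons) orbA orbb.
Qed.

Lemma odd_ucycle_verts (T : finType) (e : rel T) (s : seq T) :
  ucycle e s -> 2 < size s -> odd (size s) ->
  exists2 D : subgraph T, odd_cycle e D & verts D = [set:: s].
Proof.
case: s => // x p cs sz os; exists (walk_graph x (rcons p x)).
  by exists x, p.
by apply/setP => z; rewrite !(inE, mem_rcons) orbA orbb.
Qed.

Theorem theorem4p7 (T : finType) (e : rel T)
    (e_sym : symmetric e) (e_irr : irreflexive e)
    (HG : even_linked e)
    (C C' : subgraph T) (HC : two_odd_cycles e C C')
    (A B : {set T})
    (HAB : bipartition_of e (~: cycle_degree2 e C C') A B)
    (HcardAB : #|A| = #|B| + 1) :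
  [/\ #|corona e| + #|core e| = 2 * alpha e,
      nbhd e (core e) = A
    & partition [set corona e; nbhd e (core e)] [set: T] /\
      [disjoint corona e & nbhd e (core e)]].
Proof.
case: HG => [[_ conn] bc _ [n [Gs [_ oG [D [P [l [[oD [dD _]] _ _]]]] _]]]].
case: HC => _ HC.
have [s [cs sz os Cs]] := odd_cycle_verts ((HC C).2 (or_introl erefl)).
have [s' [cs' sz' os' Cs']] := odd_cycle_verts ((HC C').2 (or_intror erefl)).
(* From here on odd cycles are compared by their vertex sets only. *)
have H : only_odd_cycles e s s'.
  move=> t ct st ot; have [E oE <-] := odd_ucycle_verts ct st ot.
  by rewrite -Cs -Cs'; case: ((HC E).1 oE) => ->; [left|right].
have H' : only_odd_cycles e s' s by move=> t ct st ot; case: (H t ct st ot); [right|left].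
(* The initial cycle and that of the pendant are disjoint odd cycles, and no odd cycle is disjoint
   from itself, so they are [C] and [C'] in some order. *)
have dss : {in s, forall z, z \notin s'}.
  have nd E : odd_cycle e E -> ~~ [disjoint verts E & verts E].
    case/odd_cycle_verts => -[|h r] [] // _ _ _ ->.
    by apply/pred0Pn; exists h; rewrite /= !inE eqxx.
  have dCC : [disjoint verts C & verts C'].
    move: dD (nd _ oD) (nd _ oG).
    by case: ((HC D).1 oD) => ->; case: ((HC (Gs 0)).1 oG) => -> // d;
      rewrite ?d // disjoint_sym.
  move=> z zs; have := disjointFr dCC (x := z).
  by rewrite Cs Cs' !inE => ->.
have dss' : {in s', forall z, z \notin s}.
  by move=> z zs'; apply: contraTN zs'; apply: dss.
case: (HAB) => AB _ iA iB.
have ABE z : (z \in A :|: B) = ~~ (((z \in s) || (z \in s')) && (degree e z == 2)).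
  by rewrite AB /cycle_degree2 Cs Cs' !inE.
have cAB z : z \notin s -> z \notin s' -> z \in A :|: B.
  by rewrite ABE => /negPf -> /negPf ->.
have cAB' z : z \notin s' -> z \notin s -> z \in A :|: B by move=> ? ?; apply: cAB.
have dAB (r : seq T) : {in r, forall z, degree e z != 2 -> z \in A :|: B}.
  by move=> z _ /negPf dz; rewrite ABE dz andbF.
have s0 : s != [::] by case: (s) sz.
have s'0 : s' != [::] by case: (s') sz'.
have [c [p [cp [szp op] mp dc dp]]] :=
  attached_cycle e_sym e_irr conn bc cs sz os cs' s'0 dss H iA iB cAB (dAB s).
have [c' [p' [cp' [szp' op'] mp' dc' dp']]] :=
  attached_cycle e_sym e_irr conn bc cs' sz' os' cs s0 dss' H' iA iB cAB' (dAB s').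
have dpp : {in c :: p, forall z, z \notin c' :: p'}.
  by move=> z; rewrite -mp -mp'; apply: dss.
have XE : cycle_degree2 e C C' = [set:: p] :|: [set:: p'].
  apply/setP => z; rewrite /cycle_degree2 Cs Cs' !inE mp mp' !inE; apply/idP/idP.
    case/andP=> /orP [] /predU1P [->|->]; rewrite ?orbT //.
      by rewrite (negPf dc).
    by rewrite (negPf dc').
  by case/orP=> zp; rewrite zp ?(dp z zp) ?(dp' z zp) ?orbT.
rewrite XE in HAB.
have [cardE NE coronaE] :=
  two_attached_cycles e_sym bc cp szp op dp cp' szp' op' dp' dpp HAB HcardAB.
rewrite cardE NE coronaE; split=> //.
apply: partition_setC; first by rewrite -card_gt0 HcardAB addn1.
apply/set0Pn; case: p' {cp' op' mp' dp' dpp HAB} szp' XE => // z r _ XE.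
exists z; rewrite inE; apply/negP => zA.
have : z \in A :|: B by rewrite inE zA.
by rewrite AB XE !inE eqxx !orbT.
Qed.
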